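(* Let $\mathcal H=\{H_i\}_{i\in I}$ be a family of atomic monoids indexed by a non-empty (possibly infinite) set $I$. Let $\mathsf P_{\mathcal H}$ be the submonoid of the direct product $\prod_{i\in I}H_i$ generated by the set $$\{f: f(i)\in H_i^\times\text{ for every }i\in I\}\cup\{f: f(i)\in\mathscr A(H_i)\text{ for every }i\in I\},$$ and for each $i\in I$ let $\pi_i\colon\mathsf P_{\mathcal H}\to H_i$ be the restriction of the canonical projection $\prod_{j\in I}H_j\to H_i$. Then $(\mathsf P_{\mathcal H},\{\pi_i: i\in I\})$ is the product of $\mathcal H$ in the category $\mathsf{AtoMon}$.
   Context: Monoids are not assumed commutative. For a monoid $H$, $H^\times$ is the group of units (two-sided invertible elements). An atom of $H$ is a non-unit $a\in H$ such that $a=xy$ with $x,y\in H$ implies $x\in H^\times$ or $y\in H^\times$; $\mathscr A(H)$ is the set of atoms. $H$ is atomic if every non-unit of $H$ is a (non-empty, finite) product of atoms. A monoid homomorphism $f\colon H\to K$ is atom-preserving if $f(a)\in\mathscr A(K)$ for every $a\in\mathscr A(H)$. $\mathsf{AtoMon}$ is the category whose objects are the atomic monoids and whose morphisms are the atom-preserving monoid homomorphisms between atomic monoids. The direct product $\prod_{i\in I}H_i$ carries componentwise multiplication; its elements are viewed as functions $f$ on $I$ with $f(i)\in H_i$. *)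

(* Defs.v *)
From HB Require Import structures.
From mathcomp Require Import all_boot.
From mathcomp Require Import boolp classical_sets.

Set Implicit Arguments.
Unset Strict Implicit.
Unset Printing Implicit Defensive.

Local Open Scope classical_set_scope.
Local Open Scope group_scope.

Record category := Category {
  obj :> Type;
  hom : obj -> obj -> Type;
  idm : forall A, hom A A;
  comp : forall A B C, hom B C -> hom A B -> hom A C;
  comp1m : forall A B (f : hom A B), comp (idm B) f = f;
  compm1 : forall A B (f : hom A B), comp f (idm A) = f;
  compA : forall A B C D (h : hom C D) (g : hom B C) (f : hom A B),
    comp h (comp g f) = comp (comp h g) f
}.
Arguments hom {c} A B.
Arguments idm {c} A.
Arguments comp {c A B C} g f.

Definition is_product (C : category) (I : Type) (X : I -> C) (P : C)
    (p : forall i, hom P (X i)) : Prop :=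
  forall (Y : C) (f : forall i, hom Y (X i)),
    exists! u : hom Y P, forall i, comp (p i) u = f i.

(* A monoidType carries a choiceType structure; in the presence of the choice
   axiom of boolp every type has one, and morphisms ignore it, so that this is
   no restriction on the monoids considered. *)
Section Atoms.
Variable H : monoidType.

Definition units : set H := [set x | exists y, x * y = 1 /\ y * x = 1].

Definition atoms : set H :=
  [set a | ~ units a /\ forall x y, a = x * y -> units x \/ units y].

Definition atomic : Prop :=
  forall x, ~ units x -> exists s : seq H,
    [/\ s <> [::], forall a, a \in s -> atoms a & x = \prod_(a <- s) a].

End Atoms.

Definition atom_preserving (H K : monoidType) (f : H -> K) : Prop :=
  forall a, atoms a -> atoms (f a).

Record atomicMonoid := AtomicMonoid {
  atomic_sort :> monoidType;
  atomicP : atomic atomic_sort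
}.

Record atomHom (H K : monoidType) := AtomHom {
  atomHom_fun :> UMagmaMorphism.type H K;
  atomHomP : atom_preserving atomHom_fun
}.

Lemma umorph_ext (H K : monoidType) (f g : UMagmaMorphism.type H K) :
  f =1 g -> f = g.
Proof.
case: f g => [f [[fM] [f1]]] [g [[gM] [g1]]] /= /funext fg; subst g.
by congr (UMagmaMorphism.Pack (UMagmaMorphism.Class _ _));
  [rewrite (Prop_irrelevance fM gM) | rewrite (Prop_irrelevance f1 g1)].
Qed.

Lemma atomHom_ext (H K : monoidType) (f g : atomHom H K) : f =1 g -> f = g.
Proof.
case: f g => [f fP] [g gP] /= /umorph_ext fg; subst g.
by rewrite (Prop_irrelevance fP gP).
Qed.

Definition atomHom_id (H : monoidType) : atomHom H H :=
  @AtomHom H H (idfun : UMagmaMorphism.type H H) (fun a ha => ha).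

Definition atomHom_comp (H K L : monoidType) (g : atomHom K L)
    (f : atomHom H K) : atomHom H L :=
  @AtomHom H L (g \o f : UMagmaMorphism.type H L)
    (fun a ha => atomHomP g (atomHomP f ha)).

Lemma atomHom_comp1m (H K : monoidType) (f : atomHom H K) :
  atomHom_comp (atomHom_id K) f = f.
Proof. exact: atomHom_ext. Qed.

Lemma atomHom_compm1 (H K : monoidType) (f : atomHom H K) :
  atomHom_comp f (atomHom_id H) = f.
Proof. exact: atomHom_ext. Qed.

Lemma atomHom_compA (H K L M : monoidType) (h : atomHom L M) (g : atomHom K L)
    (f : atomHom H K) :
  atomHom_comp h (atomHom_comp g f) = atomHom_comp (atomHom_comp h g) f.
Proof. exact: atomHom_ext. Qed.

Definition AtoMon : category :=
  @Category atomicMonoid (fun H K => atomHom H K) (fun H => atomHom_id H)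
    (fun H K L g f => atomHom_comp g f)
    (fun H K => @atomHom_comp1m H K) (fun H K => @atomHom_compm1 H K)
    (fun H K L M => @atomHom_compA H K L M).

Definition submonoid (M : monoidType) (S : set M) : Prop :=
  S 1 /\ forall x y, S x -> S y -> S (x * y).

Definition gen_submonoid (M : monoidType) (G : set M) : set M :=
  smallest (@submonoid M) G.

Lemma gen_submonoidP (M : monoidType) (G : set M) :
  submonoid (gen_submonoid G).
Proof.
split=> [S [[S1 _] _] //|x y Gx Gy S SG].
by case: (SG) => [[_ SM] _]; apply: SM; [exact: Gx | exact: Gy].
Qed.

Section Product.
Variables (I : Type) (H : I -> monoidType).

Definition dirprod : Type := forall i, H i.

HB.instance Definition _ := Choice.copy dirprod (forall i, H i).

Let dmul (f g : dirprod) : dirprod := fun i => f i * g i.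
Let dunit : dirprod := fun i => 1.

Let dmulA : associative dmul.
Proof. by move=> f g h; apply/functional_extensionality_dep => i; apply: mulgA. Qed.
Let dmul1g : left_id dunit dmul.
Proof. by move=> f; apply/functional_extensionality_dep => i; apply: mul1g. Qed.
Let dmulg1 : right_id dunit dmul.
Proof. by move=> f; apply/functional_extensionality_dep => i; apply: mulg1. Qed.

HB.instance Definition _ := isMonoid.Build dirprod dmulA dmul1g dmulg1.

Definition P_gens : set dirprod :=
  [set f | forall i, units (f i)] `|` [set f | forall i, atoms (f i)].

Definition P_pred : {pred dirprod} := fun f => `[< gen_submonoid P_gens f >].

Lemma P_pred_closed : monoid_closed P_pred.
Proof.
have [P1 PM] := gen_submonoidP P_gens.
by split=> [|f g /asboolP Pf /asboolP Pg]; apply/asboolP => //; apply: PM.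
Qed.

Definition P_mon : Type := {f : dirprod | P_pred f}.

HB.instance Definition _ := SubChoice.on P_mon.
HB.instance Definition _ :=
  SubChoice_isSubMonoid.Build dirprod P_pred P_mon P_pred_closed.

Definition P_proj (i : I) (f : P_mon) : H i := val f i.

Lemma P_proj_morphism i : monoid_morphism (P_proj i).
Proof. by []. Qed.

HB.instance Definition _ i :=
  isUMagmaMorphism.Build P_mon (H i) (P_proj i) (P_proj_morphism i).

End Product.

(* Main.v *)
Require Import Defs.
From HB Require Import structures.
From mathcomp Require Import all_boot.
From mathcomp Require Import boolp classical_sets.

(** In an atomic monoid only units divide units.  Indeed, an atom [a] of any
    monoid has no right inverse, since [a * b = 1] gives [a = a * (b * a)],
    whence [b * a] is a unit and so is [a] ([atom_not_right_invertible]); in an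
    atomic monoid this spreads to all non-units ([units_mull]).  Moreover, the
    product of an atom and a unit, in either order, is an atom.

    Hence units can be absorbed into neighbouring atoms, and the submonoid
    generated by the families of units and the families of atoms consists of
    the families of units and of the non-empty products of families of atoms
    ([P_mon_cases]).  The former are the units of the submonoid
    ([P_mon_unitsE]), and the latter have no unit coordinate at all
    ([ptatom_product_nonunit]): an element has either only unit coordinates or
    none.  It follows that the atoms of the submonoid are the families of atoms
    ([P_mon_atomsE]), that it is atomic and that its projections preserve
    atoms.

    Given atom-preserving morphisms [f i] from an atomic monoid [Y], the family
    [fun i => f i y] is the only possible image of [y].  It lies in the submonoid
    when [y] is a unit or an atom, hence for every [y], as [Y] is generated by
    its units and atoms ([atomic_ind]). *)

Set Implicit Arguments.
Unset Strict Implicit.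
Unset Printing Implicit Defensive.

Local Open Scope classical_set_scope.
Local Open Scope group_scope.

(** * Units and atoms *)

Lemma units1 (M : monoidType) : units (1 : M).
Proof. by exists 1; rewrite mulg1. Qed.

Lemma unitsM (M : monoidType) (x y : M) : units x -> units y -> units (x * y).
Proof.
move=> [x' [xx' x'x]] [y' [yy' y'y]]; exists (y' * x'); split.
  by rewrite mulgA -(mulgA x) yy' mulg1.
by rewrite mulgA -(mulgA y') x'x mulg1.
Qed.

Lemma units_morph (M N : monoidType) (f : UMagmaMorphism.type M N) (x : M) :
  units x -> units (f x).
Proof.
by move=> [y [xy yx]]; exists (f y); rewrite -!gmulfM xy yx gmulf1.
Qed.

Lemma units_two_sided (M : monoidType) (x y z : M) :
  x * y = 1 -> z * x = 1 -> units x.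
Proof.
move=> xy zx; exists y; split=> //.
by rewrite -[y]mul1g -zx -(mulgA z) xy mulg1.
Qed.

Lemma units_cancelr (M : monoidType) (x y : M) :
  units y -> units (x * y) -> units x.
Proof.
move=> [y' [yy' y'y]] Uxy.
rewrite -[x]mulg1 -yy' mulgA; apply: unitsM => //.
by exists y.
Qed.

Lemma units_cancell (M : monoidType) (x y : M) :
  units x -> units (x * y) -> units y.
Proof.
move=> [x' [xx' x'x]] Uxy.
rewrite -[y]mul1g -x'x -mulgA; apply: unitsM => //.
by exists x.
Qed.

Lemma atomsMunit (M : monoidType) (a u : M) :
  atoms a -> units u -> atoms (a * u).
Proof.
move=> [Na Aa] Uu; split; first by move/(units_cancelr Uu).
case: (Uu) => u' [uu' u'u] x y auE.
have Uu' : units u' by exists u.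
have : a = x * (y * u') by rewrite mulgA -auE -mulgA uu' mulg1.
by case/Aa; [left | right; exact: units_cancelr Uu' _].
Qed.

Lemma atomsUmul (M : monoidType) (u a : M) :
  units u -> atoms a -> atoms (u * a).
Proof.
move=> Uu [Na Aa]; split; first by move/(units_cancell Uu).
case: (Uu) => u' [uu' u'u] x y uaE.
have Uu' : units u' by exists u.
have : a = (u' * x) * y by rewrite -mulgA -uaE mulgA u'u mul1g.
by case/Aa; [left; exact: units_cancell Uu' _ | right].
Qed.

(** If [a * b = 1] then [a = a * (b * a)] is a factorization of the atom [a],
    so [b * a] is a unit and [a] has a left inverse as well. *)
Lemma atom_not_right_invertible (M : monoidType) (a b : M) :
  atoms a -> a * b <> 1.
Proof.
move=> [Na Aa] ab; apply: Na.
have : a = a * (b * a) by rewrite mulgA ab mul1g.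
case/Aa=> // -[z [_ zba]].
by apply: (@units_two_sided _ a b (z * b)) => //; rewrite -mulgA.
Qed.

(** A non-unit [x] has an atom as its first factor, and the right inverse of
    [x] provided by a unit [x * y] would give one to that atom. *)
Lemma units_mull (M : monoidType) (x y : M) :
  atomic M -> units (x * y) -> units x.
Proof.
move=> atM [z [xyz _]]; apply: contrapT => /atM [[|a s] [// _ As xE]].
have Aa : atoms a by apply: As; rewrite mem_head.
apply: (@atom_not_right_invertible _ a (\prod_(b <- s) b * (y * z)) Aa).
by rewrite mulgA -[X in X * _](big_cons _ _ a s xpredT id) -xE mulgA.
Qed.

Lemma atomic_ind (M : monoidType) (S : set M) :
  atomic M -> submonoid S -> (forall x, units x -> S x) ->
  (forall x, atoms x -> S x) -> forall x, S x.
Proof.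
move=> atM [S1 SM] SU SA x; case: (pselect (units x)) => [/SU //|].
case/atM=> s [_ As ->]; elim: s As => [|a s IHs] As; first by rewrite big_nil.
rewrite big_cons; apply: SM; first by apply/SA/As; rewrite mem_head.
by apply: IHs => b bs; apply: As; rewrite inE bs orbT.
Qed.

(** * The submonoid generated by families of units and families of atoms *)

Section Families.
Variables (I : Type) (H : I -> monoidType).
Implicit Types f g : P_mon H.

Definition ptunits f : Prop := forall i, units (P_proj i f).
Definition ptatoms f : Prop := forall i, atoms (P_proj i f).

Lemma P_predP (h : dirprod H) : reflect (gen_submonoid (@P_gens I H) h) (P_pred h).
Proof. exact: asboolP. Qed.

Lemma P_pred_gen (h : dirprod H) : P_gens h -> P_pred h.
Proof. by move=> gh; apply/P_predP => S [_]; exact. Qed.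

(** Coordinatewise inverses again form a family of units. *)
Lemma ptunits_units f : ptunits f -> units f.
Proof.
move=> /= Uf; pose g : dirprod H := fun i => sval (cid (Uf i)).
have gP i : P_proj i f * g i = 1 /\ g i * P_proj i f = 1.
  exact: (svalP (cid (Uf i))).
have Pg : P_pred g.
  by apply: P_pred_gen; left=> i; have [fg gf] := gP i; exists (P_proj i f).
exists (Sub g Pg : P_mon H).
by split; apply/val_inj/functional_extensionality_dep => i; have [] := gP i.
Qed.

Lemma P_mon_unitsE f : units f <-> ptunits f.
Proof.
split; last exact: ptunits_units.
by move=> Uf i; apply: units_morph.
Qed.

Definition ptatom_product f : Prop :=
  exists a s, [/\ ptatoms a, forall b, b \in s -> ptatoms b
                & f = a * \prod_(b <- s) b].

Lemma ptatom_productMr f g :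
  ptatom_product f -> ptatom_product g -> ptatom_product (f * g).
Proof.
move=> [a [s [Aa As ->]]] [b [t [Ab At ->]]].
exists a, (s ++ b :: t); split=> //; last by rewrite big_cat big_cons -mulgA.
by move=> c; rewrite mem_cat inE => /orP[/As //|/orP[/eqP-> //|/At]].
Qed.

(** The unit is absorbed by the first factor. *)
Lemma ptatom_productUl f g :
  ptunits f -> ptatom_product g -> ptatom_product (f * g).
Proof.
move=> Uf [a [s [Aa As ->]]]; exists (f * a), s; rewrite mulgA; split=> // i.
exact: (atomsUmul (Uf i) (Aa i)).
Qed.

(** The unit is absorbed by the last factor, which is [a] if [s] is empty. *)
Lemma ptatom_productUr f g :
  ptatom_product f -> ptunits g -> ptatom_product (f * g).
Proof.
move=> [a [s [Aa As ->]]] Ug; case/lastP: s As => [|s b] As.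
  exists (a * g), [::]; rewrite !big_nil !mulg1; split=> // i.
  exact: (atomsMunit (Aa i) (Ug i)).
exists a, (rcons s (b * g)); split=> //; last by rewrite !big_rcons !mulgA.
move=> c; rewrite mem_rcons inE => /orP[/eqP->|cs]; last first.
  by apply: As; rewrite mem_rcons inE cs orbT.
have Ab : ptatoms b by apply: As; rewrite mem_rcons mem_head.
by move=> i; exact: (atomsMunit (Ab i) (Ug i)).
Qed.

(** By the absorption lemmas, these two classes together are closed under
    multiplication. *)
Lemma P_mon_cases f : ptunits f \/ ptatom_product f.
Proof.
pose S (h : dirprod H) := exists2 g : P_mon H, val g = h &
  ptunits g \/ ptatom_product g.
suff [g /val_inj -> //] : S (val f).
have /P_predP := valP f; apply; split; last first.
  move=> h gh; have Ph := P_pred_gen gh; pose g : P_mon H := Sub h Ph.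
  exists g => //; case: gh => [Uh|Ah]; first by left=> i; apply: Uh.
  by right; exists g, [::]; rewrite big_nil mulg1; split=> // i; apply: Ah.
split; first by exists 1 => //; left=> i; apply: units1.
move=> _ _ [g1 <- D1] [g2 <- D2]; exists (g1 * g2) => //.
case: D1 D2 => [U1|A1] [U2|A2].
- by left=> i; apply: unitsM (U1 i) (U2 i).
- by right; apply: ptatom_productUl.
- by right; apply: ptatom_productUr.
- by right; apply: ptatom_productMr.
Qed.

Hypothesis H_atomic : forall i, atomic (H i).

(** A unit coordinate would make the same coordinate of the first factor a
    unit. *)
Lemma ptatom_product_nonunit f i : ptatom_product f -> ~ units (P_proj i f).
Proof.
move=> [a [s [Aa _ ->]]] Uf; have [Na _] := Aa i; apply: Na.
exact: (@units_mull _ _ (P_proj i (\prod_(b <- s) b)) (@H_atomic i) Uf).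
Qed.

Hypothesis I_ne : inhabited I.

(** For the direct implication, if [f = a * b * ...] had two factors or more,
    then both [a] and [b * ...] would be non-units.  For the converse, if
    [f = g * h] with neither factor a family of units, then [g] and [h] have
    no unit coordinate, although each coordinate of [f] is an atom. *)
Lemma P_mon_atomsE f : atoms f <-> ptatoms f.
Proof.
case: I_ne => i0; split=> [[Nf Af]|Af].
  case: (P_mon_cases f) => [/ptunits_units // | [a [s [Aa As fE]]]].
  case: s As fE => [|b s] As fE; first by rewrite fE big_nil mulg1.
  have [/P_mon_unitsE Ua|/P_mon_unitsE Us] := Af _ _ fE.
    by have [] := Aa i0.
  case: (@ptatom_product_nonunit (\prod_(c <- b :: s) c) i0) => //.
  exists b, s; rewrite big_cons; split=> //; first by apply: As; rewrite mem_head.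
  by move=> c cs; apply: As; rewrite inE cs orbT.
split=> [/P_mon_unitsE Uf | g h fE]; first by have [] := Af i0.
case: (P_mon_cases g) => [/ptunits_units|Ag]; first by left.
case: (P_mon_cases h) => [/ptunits_units|Ah]; first by right.
have [_ /(_ (P_proj i0 g) (P_proj i0 h))] := Af i0.
rewrite fE => /(_ erefl) [] U.
  by case: (ptatom_product_nonunit Ag U).
by case: (ptatom_product_nonunit Ah U).
Qed.

Lemma P_mon_atomic : atomic (P_mon H).
Proof.
move=> f Nf; case: (P_mon_cases f) => [/ptunits_units //|[a [s [Aa As ->]]]].
exists (a :: s); split=> //; last by rewrite big_cons.
by move=> b; rewrite inE => /orP[/eqP->|/As Ab]; apply/P_mon_atomsE.
Qed.

Lemma P_proj_atom i : atom_preserving (P_proj (H := H) i).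
Proof. by move=> f /P_mon_atomsE. Qed.

End Families.

(** * The universal property *)

Section Universal.
Variables (I : Type) (H : I -> monoidType) (Y : monoidType).
Hypothesis Y_atomic : atomic Y.
Variable f : forall i, atomHom Y (H i).

Definition family (y : Y) : dirprod H := fun i => f i y.

Lemma family1 : family 1 = 1.
Proof. by apply/functional_extensionality_dep => i; apply: gmulf1. Qed.

Lemma familyM x y : family (x * y) = family x * family y.
Proof. by apply/functional_extensionality_dep => i; apply: gmulfM. Qed.

Lemma family_P y : P_pred (family y).
Proof.
have [P1 PM] := @P_pred_closed I H.
apply: (@atomic_ind _ (fun y => P_pred (family y))) => // [|x Ux|x Ax].
- by split=> [|x z Px Pz]; [rewrite family1 | rewrite familyM; apply: PM].
- by apply: P_pred_gen; left=> i; apply: units_morph.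
- by apply: P_pred_gen; right=> i; apply: atomHomP.
Qed.

Definition tupling (y : Y) : P_mon H := Sub (family y) (family_P y).

Lemma tupling_morphism : monoid_morphism tupling.
Proof. by split=> [|x y]; apply: val_inj; [apply: family1|apply: familyM]. Qed.

HB.instance Definition _ :=
  isUMagmaMorphism.Build Y (P_mon H) tupling tupling_morphism.

Hypotheses (H_atomic : forall i, atomic (H i)) (I_ne : inhabited I).

Lemma tupling_atom : atom_preserving tupling.
Proof. by move=> a Aa; apply/P_mon_atomsE => // i; apply: atomHomP. Qed.

Definition tupling_hom : atomHom Y (P_mon H) := AtomHom tupling_atom.

End Universal.

Theorem theorem5p4 (I : Type) (H : I -> atomicMonoid) (I_ne : inhabited I) :
  exists (P_atomic : atomic (P_mon (fun i => H i)))
         (proj_atom : forall i,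
            atom_preserving (P_proj (H := fun i => H i) i)),
    is_product (C := AtoMon) (X := H) (P := AtomicMonoid P_atomic)
      (fun i => AtomHom (proj_atom i)).
Proof.
have H_atomic i : atomic (H i) by apply: atomicP.
exists (P_mon_atomic H_atomic I_ne), (P_proj_atom H_atomic I_ne) => Y f.
exists (tupling_hom (@atomicP Y) f H_atomic I_ne); split.
  by move=> i; apply: atomHom_ext.
move=> u uP; apply: atomHom_ext => y.
apply/val_inj/functional_extensionality_dep => i.
by have := congr1 (fun g : atomHom Y (H i) => g y) (uP i).
Qed.
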